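(* Let $w$ be a positive integer, let $F$ be a positive odd integer, and let $a_1,\dots,a_w$ be integers with $0<a_i<F$ for each $i$. For $\operatorname{Re}(s)>w$ define the partial zeta function $$S^{(w)}(s;a_1,\dots,a_w\mid F)=2^w\sum_{\substack{m_1,\dots,m_w>0\\ m_i\equiv a_i \ (\mathrm{mod}\ F)}}\frac{(-1)^{m_1+\cdots+m_w}}{(m_1+\cdots+m_w)^s},$$ and for $x\neq 0,-1,-2,\dots$ the multiple Genocchi zeta function $$\zeta_G^{(w)}(s,x)=2^w\sum_{n_1,\dots,n_w\ge 0}\frac{(-1)^{n_1+\cdots+n_w}}{(x+n_1+\cdots+n_w)^s}.$$ Then $$S^{(w)}(s;a_1,\dots,a_w\mid F)=(-1)^{a_1+\cdots+a_w}F^{-s}\,\zeta_G^{(w)}\!\left(s,\frac{a_1+\cdots+a_w}{F}\right).$$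
   Context: Both series converge absolutely for $\operatorname{Re}(s)>w$; powers $y^{-s}$ with $y>0$ denote the principal branch $e^{-s\log y}$. *)

(* Defs.v *)
From HB Require Import structures.
From mathcomp Require Import all_boot all_order all_algebra.
From mathcomp Require Import finmap.
From mathcomp Require Import complex.
From mathcomp.analysis.showcase Require Export summability.
From mathcomp Require Import all_classical all_reals all_analysis.

Set Implicit Arguments.
Unset Strict Implicit.
Unset Printing Implicit Defensive.

Import Order.TTheory GRing.Theory Num.Theory.
Import numFieldNormedType.Exports.

Local Open Scope classical_set_scope.
Local Open Scope complex_scope.
Local Open Scope ring_scope.

Section ComplexPower.
Variable R : realType.
Implicit Types (z s : R[i]).

Definition cmod z : R := Normc.normc z.

Definition cexp z : R[i] :=
  (expR (complex.Re z))%:C * (cos (complex.Im z) +i* sin (complex.Im z)).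

(* Principal argument of z != 0, with values in ]-pi, pi]. *)
Definition carg z : R :=
  if 0 <= complex.Im z then acos (complex.Re z / cmod z)
  else - acos (complex.Re z / cmod z).

Definition clog z : R[i] := ln (cmod z) +i* carg z.

(* Principal branch of z ^ s; meaningful for z != 0. *)
Definition cpow z s : R[i] := cexp (s * clog z).

End ComplexPower.

Section Series.
Variables (R : realType) (I : choiceType).

(* Unordered sum of f over D: the limit of the sums of f (set to 0 outside D)
   over finite sets of indices, directed by inclusion. *)
Definition csum (D : set I) (f : I -> R[i]) : R[i] :=
  @summability.sum I R[i] R[i]^o (patch (fun=> 0) D f).

Definition abs_cvg (D : set I) (f : I -> R[i]) : Prop :=
  esum.summable D (fun i => (cmod (f i))%:E).

End Series.

Section Zeta.
Variable R : realType.

Definition weight (w : nat) (m : {ffun 'I_w -> nat}) : nat :=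
  (\sum_(i < w) m i)%N.

Definition S_dom (w : nat) (a : 'I_w -> nat) (F : nat) :
    set {ffun 'I_w -> nat} :=
  [set m | forall i, (0 < m i)%N /\ m i = a i %[mod F]].

Definition S_term (w : nat) (s : R[i]) (m : {ffun 'I_w -> nat}) : R[i] :=
  (-1) ^+ weight m * cpow (weight m)%:R (- s).

Definition partial_S (w : nat) (s : R[i]) (a : 'I_w -> nat) (F : nat) : R[i] :=
  2 ^+ w * csum (S_dom a F) (S_term s).

Definition zetaG_term (w : nat) (s x : R[i]) (n : {ffun 'I_w -> nat}) : R[i] :=
  (-1) ^+ weight n * cpow (x + (weight n)%:R) (- s).

(* Meaningful when x is not a nonpositive integer. *)
Definition zetaG (w : nat) (s x : R[i]) : R[i] :=
  2 ^+ w * csum [set: {ffun 'I_w -> nat}] (zetaG_term s x).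

End Zeta.

(* Main.v *)
(** The map [n |-> a + F n] is a bijection from [nat^w] onto the tuples of
    positive integers congruent to [a] modulo [F]. Since [F] is odd, it turns
    the terms of [S] into those of [zetaG] at [x = A / F] multiplied by
    [(-1)^A F^-s]; unordered sums and absolute convergence are invariant under
    injective reindexing, so only the convergence of [zetaG] has to be proved.
    For it, write [x + n_1 + ... + n_w] as the sum of the [t_i = x / w + n_i].
    Each [t_i] is at most that sum, so with [p = Re s / w > 1] the [w]-fold
    series is bounded by the [w]-th power of [\sum_k (x / w + k) `^ (- p)]. *)

Require Import Defs.
From mathcomp Require Import all_boot all_order all_algebra.
From mathcomp Require Import complex finmap ring.
From mathcomp Require Import all_classical all_reals all_analysis.

Set Implicit Arguments.
Unset Strict Implicit.
Unset Printing Implicit Defensive.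

Import Order.TTheory GRing.Theory Num.Theory.
Import numFieldNormedType.Exports.

Local Open Scope classical_set_scope.
Local Open Scope complex_scope.
Local Open Scope ring_scope.

Section PositiveBase.
Variable R : realType.
Implicit Types (x y : R) (z s : R[i]).

Lemma cexpD z s : cexp (z + s) = cexp z * cexp s.
Proof.
case: z s => [a b] [c d]; rewrite /cexp /= expRD cosD sinD.
by simpc; congr (_ +i* _); ring.
Qed.

Lemma cmod_cexp z : cmod (cexp z) = expR (complex.Re z).
Proof.
rewrite /cmod Normc.normcM /= expr0n /= addr0 sqrtr_sqr.
by rewrite cos2Dsin2 sqrtr1 mulr1 gtr0_norm ?expR_gt0.
Qed.

Lemma clog_pos x : 0 < x -> clog x%:C = (ln x)%:C.
Proof.
move=> x0; rewrite /clog /carg /cmod /= lexx expr0n /= addr0 sqrtr_sqr.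
by rewrite gtr0_norm // divff ?gt_eqF // acos1.
Qed.

Lemma cpow_posM x y s : 0 < x -> 0 < y ->
  cpow (x%:C * y%:C) s = cpow x%:C s * cpow y%:C s.
Proof.
move=> x0 y0; rewrite /cpow -rmorphM /= !clog_pos ?mulr_gt0 //.
by rewrite lnM // rmorphD mulrDr cexpD.
Qed.

Lemma cmod_cpow_pos x s : 0 < x -> cmod (cpow x%:C s) = x `^ complex.Re s.
Proof.
move=> x0; rewrite /cpow clog_pos // cmod_cexp /powR gt_eqF //.
by case: s => u v /=; rewrite mulr0 subr0.
Qed.

Lemma cmod_signM (n : nat) z : cmod ((-1) ^+ n * z) = cmod z.
Proof.
by rewrite /cmod -signr_odd; case: odd; rewrite ?mul1r // mulN1r normcN.
Qed.

End PositiveBase.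

Section ExtendedSums.
Variable R : realType.

Lemma lee_prod (I : Type) (r : seq I) (P : pred I) (f g : I -> \bar R) :
  (forall i, P i -> 0 <= f i <= g i)%E ->
  (\prod_(i <- r | P i) f i <= \prod_(i <- r | P i) g i)%E.
Proof.
move=> fg; suff /andP[] : (0 <= \prod_(i <- r | P i) f i <=
  \prod_(i <- r | P i) g i)%E by [].
elim/big_ind2 : _ => [|x1 x2 y1 y2 /andP[x0 x12] /andP[y0 y12]|//].
  by rewrite lee01 lexx.
by rewrite mule_ge0 ?lee_pmul.
Qed.

Lemma esum_prod_ffun_le (I : finType) (J : choiceType) (h : I -> J -> R) :
  (forall i j, 0 <= h i j) ->
  (\esum_(f in [set: {ffun I -> J}]) (\prod_i h i (f i))%:E <=
   \prod_i \esum_(j in [set: J]) (h i j)%:E)%E.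
Proof.
move=> h0; apply: ge_ereal_sup => _ [X [finX _] <-].
pose values := \bigcup_(i in [set: I]) (fun f : {ffun I -> J} => f i) @` X.
have fin_values : finite_set values.
  by apply: bigcup_finite => // i _; exact: finite_image.
pose B := fset_set values.
pose incl (g : {ffun I -> B}) : {ffun I -> J} := [ffun i => val (g i)].
have incl_inj : injective incl.
  move=> g k /ffunP gk; apply/ffunP => i; apply: val_inj.
  by have := gk i; rewrite !ffunE.
have X_incl : X `<=` range incl.
  move=> f Xf; have fB i : f i \in B.
    by rewrite in_fset_set // inE; exists i => //; exists f.
  by exists [ffun i => [` fB i]%fset] => //; apply/ffunP => i; rewrite !ffunE.
apply: (@le_trans _ _ (\sum_(f \in range incl) (\prod_i h i (f i))%:E)%E).
  apply: lee_fsum_nneg_subset => //.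
  - exact: finite_image.
  - by move=> f /[!inE]; exact: X_incl.
  - by move=> f _; rewrite lee_fin prodr_ge0.
rewrite fsbig_image; last by move=> g k _ _; exact: incl_inj.
have -> : [set: {ffun I -> B}] = [set` index_enum {ffun I -> B}].
  by apply/seteqP; split=> g //= _; rewrite mem_index_enum.
rewrite -fsbig_seq ?index_enum_uniq // sumEFin.
under eq_bigr do under eq_bigr do rewrite ffunE.
rewrite -(bigA_distr_bigA (fun i (j : B) => h i (val j))) -prodEFin.
apply: lee_prod => i _; rewrite lee_fin sumr_ge0 //=.
apply: esum_ge; exists [set` B]; first by split.
by rewrite -fsbig_seq // sumEFin big_seq_fsetE.
Qed.

End ExtendedSums.

Section PowerSums.
Variable R : realType.
Implicit Types (t x y p q : R).

Lemma bernoulli_powRN t q : 0 < t -> 0 <= q -> 1 + q * (1 - t) <= t `^ (- q).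
Proof.
move=> t0 q0; rewrite /powR gt_eqF // mulNr -mulrN.
apply: le_trans (expR_ge1Dx _); rewrite lerD2l ler_wpM2l // lerNr opprB.
by have := @le_ln1Dx R (t - 1); rewrite subrKC; apply; rewrite ltrBrDr addNr.
Qed.

Lemma powRN_succ_le_telescope x q : 0 < x -> 0 <= q ->
  q * (x + 1) `^ (- (q + 1)) <= x `^ (- q) - (x + 1) `^ (- q).
Proof.
move=> x0 q0; have x1_gt0 : 0 < x + 1 by rewrite addr_gt0.
have -> : (x + 1) `^ (- (q + 1)) = (x + 1) `^ (- q) / (x + 1).
  rewrite opprD powRD; last by rewrite (gt_eqF x1_gt0) implybT.
  by rewrite powR_inv1 // ltW.
have -> : x `^ (- q) = (x + 1) `^ (- q) * (x / (x + 1)) `^ (- q).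
  by rewrite -powRM ?divr_ge0 ?ltW // mulrC divfK ?gt_eqF.
rewrite mulrCA -[X in _ <= _ - X]mulr1 -mulrBr ler_pM2l ?powR_gt0 // lerBrDl.
have := bernoulli_powRN (divr_gt0 x0 x1_gt0) q0.
by have -> : 1 - x / (x + 1) = (x + 1)^-1 by field; rewrite gt_eqF.
Qed.

Lemma sum_powRN_le y q n : 0 < y -> 0 < q ->
  \sum_(k < n) (y + k%:R) `^ (- (q + 1)) <= y `^ (- (q + 1)) + y `^ (- q) / q.
Proof.
move=> y0 q0.
case: n => [|n]; first by rewrite big_ord0 addr_ge0 ?divr_ge0 ?powR_ge0 // ltW.
rewrite big_ord_recl addr0 lerD2l ler_pdivlMr // mulrC mulr_sumr.
pose u k := (y + k%:R) `^ (- q).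
have -> : y `^ (- q) = u 0 by rewrite /u addr0.
apply: (@le_trans _ _ (u 0 - u n)); last by rewrite gerBl powR_ge0.
rewrite -[leRHS]opprB -telescope_sumr // -sumrN big_mkord.
apply: ler_sum => k _; rewrite opprB /u lift0 -natr1 addrA.
by apply: powRN_succ_le_telescope; rewrite ?ltr_wpDr // ltW.
Qed.

Lemma esum_powRN_lty y p : 0 < y -> 1 < p ->
  (\esum_(k in [set: nat]) ((y + k%:R) `^ (- p))%:E < +oo)%E.
Proof.
move=> y0 p1; pose q := p - 1; have q0 : 0 < q by rewrite subr_gt0.
have term_ge0 k : (0 <= ((y + k%:R) `^ (- p))%:E)%E by rewrite lee_fin powR_ge0.
rewrite -nneseries_esumT //.
apply: (@le_lt_trans _ _ (y `^ (- p) + y `^ (- q) / q)%:E); last exact: ltry.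
apply: lime_le; first exact: is_cvg_nneseries.
apply: nearW => n; rewrite big_mkord sumEFin lee_fin.
have -> : p = q + 1 by rewrite subrK.
exact: (sum_powRN_le n y0 q0).
Qed.

Lemma powRN_sum_le_prod (I : finType) (t : I -> R) p :
  (forall i, 0 < t i) -> 0 <= p ->
  (\sum_i t i) `^ (- (#|I|%:R * p)) <= \prod_i t i `^ (- p).
Proof.
move=> t0 p0; have t_le_sum i : t i <= \sum_j t j.
  by rewrite (bigD1 i) //= lerDl sumr_ge0 // => j _; rewrite ltW.
rewrite mulrC -mulNr powRrM powR_mulrn ?powR_ge0 // -prodr_const.
apply: ler_prod => i _; have sum_gt0 := lt_le_trans (t0 i) (t_le_sum i).
rewrite powR_ge0 /= !powRN lef_pV2 ?posrE ?powR_gt0 //.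
by apply: ge0_ler_powR; rewrite ?nnegrE // ltW.
Qed.

End PowerSums.

Section UnorderedSums.
Variable R : realType.

Lemma abs_cvgZl (I : choiceType) (D : set I) (f : I -> R[i]) (c : R[i]) :
  abs_cvg D f -> abs_cvg D (fun i => c * f i).
Proof.
move=> f_cvg; have norm_ge0 i : (0 <= `|(cmod (f i))%:E|)%E by exact: abse_ge0.
apply: (@le_lt_trans _ _
    (`|(cmod c)%:E| * \esum_(i in D) `|(cmod (f i))%:E|)%E); last first.
  by rewrite lte_mul_pinfty.
apply: ge_ereal_sup => _ [X [finX XD] <-].
under eq_fsbigr do rewrite /cmod Normc.normcM EFinM abseM.
rewrite -ge0_mule_fsumr //; apply: lee_wpmul2l => //.
by apply: esum_ge; exists X.
Qed.

Lemma abs_cvg_image (I J : choiceType) (D : set I) (e : I -> J)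
    (f : J -> R[i]) :
  set_inj D e -> abs_cvg (e @` D) f = abs_cvg D (f \o e).
Proof. by move=> e_inj; rewrite /abs_cvg /esum.summable esum_image. Qed.

Lemma partial_sum_patch (I : choiceType) (V : zmodType) (D : set I) (f : I -> V)
    (B : {fset I}) :
  partial_sum (patch (fun=> 0) D f) B = \sum_(i \in [set` B] `&` D) f i.
Proof.
rewrite fsbig_mkcondr -fsbig_seq ?fset_uniq // /partial_sum.
by rewrite big_seq_fsetE.
Qed.

#[local] Existing Instance totally_filter.

Lemma csumZ (I : choiceType) (D : set I) (f : I -> R[i]) (c : R[i]) :
  csum D (fun i => c * f i) = c * csum D f.
Proof.
rewrite /csum /summability.sum.
have -> : partial_sum (patch (fun=> 0) D (fun i => c * f i) : I -> R[i]^o) =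
          c *: partial_sum (patch (fun=> 0) D f : I -> R[i]^o).
  apply/funext => A; rewrite /partial_sum [RHS]scaler_sumr.
  apply: eq_bigr => i _.
  by rewrite /patch; case: ifP => // _; rewrite scaler0.
have [->|c_neq0] := eqVneq c 0.
  rewrite mul0r scale0r.
  exact: (@lim_cst _ (@norm_hausdorff _ R[i]^o) _ _ _ 0).
have [fcvg|fdvg] := pselect (cvg
    (partial_sum (patch (fun=> 0) D f : I -> R[i]^o) @ totally)).
  exact: (@limZl_tmp _ _ _ _ _ c _ fcvg).
(* Divergent sums take the junk value [point], which is [0] in [R[i]]. *)
rewrite (dvgP fdvg) dvgP ?is_cvgZlE //.
exact/esym/mulr0.
Qed.

Lemma finite_setI_preimage (I J : Type) (D : set I) (e : I -> J) (B : set J) :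
  set_inj D e -> finite_set B -> finite_set (D `&` e @^-1` B).
Proof.
move=> e_inj finB.
have e_inj_preim : set_inj (D `&` e @^-1` B) e.
  by apply: sub_in2 e_inj => i /[!inE] -[].
rewrite -(eq_finite_set (inj_card_eq e_inj_preim)).
by apply: sub_finite_set finB => _ /= [i [_ eiB] <-].
Qed.

(* The sum over a finite set [B] only depends on [B `&` e @` D], so [B] may be
   enlarged outside of [e @` D] to compare the two filters of partial sums. *)
Lemma csum_image (I J : choiceType) (D : set I) (e : I -> J) (f : J -> R[i]) :
  set_inj D e -> csum (e @` D) f = csum D (f \o e).
Proof.
move=> e_inj; rewrite /csum /summability.sum.
set p := partial_sum _; set q := partial_sum _.
have sum_eq (B : {fset J}) (C : {fset I}) :
    [set` B] `&` e @` D = e @` ([set` C] `&` D) -> p B = q C.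
  rewrite /p /q !partial_sum_patch => ->; apply: fsbig_image.
  by apply: sub_in2 e_inj => i /[!inE] -[].
have fin_preim (B : {fset J}) : finite_set (D `&` e @^-1` [set` B]).
  exact: finite_setI_preimage e_inj (finite_fset B).
suff -> : p @ totally = q @ totally by [].
apply/seteqP; split=> U [A _ AU].
- exists (fset_set (D `&` e @^-1` [set` A])) => // C /fsubsetP C_sub.
  pose CD := fset_set ([set` C] `&` D).
  have finCD : finite_set ([set` C] `&` D) by exact: finite_setIl.
  rewrite /= -(sum_eq (A `|` e @` CD)%fset); first exact/AU/fsubsetUl.
  rewrite set_fsetU set_imfset /= fset_setK // setIUl.
  apply/seteqP; split=> [j [[jA [i Di eij]]|[]//]|_ [i [iC iD] <-]]; last first.
    by right; split; exists i.
  exists i => //; split => //; apply: C_sub.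
  by rewrite in_fset_set // inE; split => //=; rewrite eij.
- exists (e @` A)%fset => // B /fsubsetP eA_sub.
  pose C := fset_set (D `&` e @^-1` [set` B]).
  rewrite /= (sum_eq _ (A `|` C)%fset); first exact/AU/fsubsetUl.
  rewrite set_fsetU fset_setK //.
  apply/seteqP; split=> [j [jB [i Di eij]]|_ [i [[iA|[_ eiB]] Di] <-]].
  - by exists i => //; split => //; right; split => //=; rewrite eij.
  - by split; [apply: eA_sub; rewrite in_imfset|exists i].
  - by split; last exists i.
Qed.

End UnorderedSums.

Section ResidueClass.
Variables (w F : nat) (a : 'I_w -> nat).
Implicit Types n : {ffun 'I_w -> nat}.

Definition lift_residue n : {ffun 'I_w -> nat} := [ffun i => a i + F * n i]%N.

Lemma weight_lift_residue n :
  weight (lift_residue n) = (\sum_(i < w) a i + F * weight n)%N.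
Proof.
rewrite /weight big_distrr /= -big_split /=.
by apply: eq_bigr => i _; rewrite ffunE.
Qed.

Lemma lift_residue_inj : (0 < F)%N -> injective lift_residue.
Proof.
move=> F_gt0 m n /ffunP lift_eq; apply/ffunP => i; apply/eqP.
by have /eqP := lift_eq i; rewrite !ffunE eqn_add2l eqn_pmul2l.
Qed.

Lemma range_lift_residue :
  (forall i, 0 < a i < F)%N -> range lift_residue = S_dom a F.
Proof.
move=> a_bnd; apply/seteqP; split=> [_ [n _ <-] i|m mD].
  have /andP[a_gt0 _] := a_bnd i.
  by rewrite ffunE addn_gt0 a_gt0 addnC mulnC modnMDl.
exists [ffun i => m i %/ F]%N => //; apply/ffunP => i; rewrite !ffunE.
have /andP[_ aF] := a_bnd i; have [_ m_mod] := mD i.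
by rewrite [RHS](divn_eq _ F) m_mod (modn_small aF) addnC mulnC.
Qed.

End ResidueClass.

Section GenocchiZeta.
Variables (R : realType) (w : nat) (s : R[i]).
Implicit Types n : {ffun 'I_w -> nat}.

Lemma cmod_zetaG_term (x : R) n : 0 < x ->
  cmod (zetaG_term s x%:C n) = (x + (weight n)%:R) `^ (- complex.Re s).
Proof.
move=> x0; rewrite /zetaG_term -(rmorph_nat (real_complex R) (weight n)).
rewrite -rmorphD cmod_signM cmod_cpow_pos ?ltr_wpDr //.
by case: s.
Qed.

Lemma cmod_zetaG_term_le (x : R) n :
  (0 < w)%N -> 0 < x -> 0 <= complex.Re s ->
  cmod (zetaG_term s x%:C n) <=
  \prod_i (x / w%:R + (n i)%:R) `^ (- (complex.Re s / w%:R)).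
Proof.
move=> w_gt0 x0 s_ge0; have w_neq0 : w%:R != 0 :> R by rewrite pnatr_eq0 -lt0n.
have sE : complex.Re s = #|'I_w|%:R * (complex.Re s / w%:R).
  by rewrite card_ord mulrC divfK.
have sumE : x + (weight n)%:R = \sum_i (x / w%:R + (n i)%:R).
  rewrite big_split sumr_const card_ord -[_ *+ w]mulr_natr divfK //.
  by rewrite /weight natr_sum.
rewrite cmod_zetaG_term // {1}sE sumE; apply: powRN_sum_le_prod => [i|].
  by rewrite ltr_wpDr // divr_gt0 // ltr0n.
by rewrite divr_ge0.
Qed.

Lemma abs_cvg_zetaG (x : R) : (0 < w)%N -> 0 < x -> w%:R < complex.Re s ->
  abs_cvg [set: {ffun 'I_w -> nat}] (zetaG_term s x%:C).
Proof.
move=> w_gt0 x0 s_gtw; have wR_gt0 : 0 < w%:R :> R by rewrite ltr0n.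
pose h (_ : 'I_w) (k : nat) := (x / w%:R + k%:R) `^ (- (complex.Re s / w%:R)).
have h_ge0 i k : 0 <= h i k by exact: powR_ge0.
apply: (@le_lt_trans _ _ (\esum_(n in [set: {ffun 'I_w -> nat}])
    (\prod_i h i (n i))%:E)%E).
  apply: le_esum => n _; rewrite gee0_abs lee_fin.
    by rewrite cmod_zetaG_term_le // ltW // (lt_trans wR_gt0).
  by rewrite cmod_zetaG_term ?powR_ge0.
apply: le_lt_trans (esum_prod_ffun_le h_ge0) _.
rewrite ltey_eq prode_fin_num ?orbT // => i _.
rewrite ge0_fin_numE; last by apply: esum_ge0 => k _; rewrite lee_fin.
by apply: esum_powRN_lty; rewrite ?divr_gt0 // ltr_pdivlMr // mul1r.
Qed.

Lemma S_term_lift_residue (F : nat) (a : 'I_w -> nat) n : odd F ->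
  (0 < \sum_(i < w) a i)%N ->
  S_term s (lift_residue F a n) =
  (-1) ^+ (\sum_(i < w) a i) * cpow F%:R (- s) *
  zetaG_term s ((\sum_(i < w) a i)%:R / F%:R) n.
Proof.
move=> F_odd A_gt0; have F_gt0 := odd_gt0 F_odd.
rewrite /S_term /zetaG_term weight_lift_residue.
set A := (\sum_(i < w) a i)%N in A_gt0 *; set N := weight n.
have F_real : F%:R = (F%:R : R)%:C.
  by rewrite -[LHS](rmorph_nat (real_complex R)).
have base_real : A%:R / F%:R + N%:R = (A%:R / F%:R + N%:R : R)%:C.
  by rewrite rmorphD rmorph_nat fmorph_div !rmorph_nat.
have -> : (A + F * N)%:R = F%:R * (A%:R / F%:R + N%:R) :> R[i].
  by rewrite natrD natrM mulrDr mulrCA divff ?mulr1 // pnatr_eq0 -lt0n.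
rewrite base_real F_real cpow_posM ?ltr0n //; last first.
  by rewrite ltr_wpDr // divr_gt0 ?ltr0n.
rewrite exprD exprM -[(-1) ^+ F]signr_odd F_odd expr1.
by rewrite [RHS]mulrACA.
Qed.

End GenocchiZeta.

Theorem theorem2 (R : realType) (w : nat) (F : nat) (a : 'I_w -> nat) (s : R[i])
    (w_gt0 : (0 < w)%N) (F_gt0 : (0 < F)%N) (F_odd : odd F)
    (a_bnd : forall i : 'I_w, (0 < a i < F)%N)
    (s_gtw : w%:R < complex.Re s) :
  let A := (\sum_(i < w) a i)%N in
  let x : R[i] := A%:R / F%:R in
  [/\ abs_cvg (S_dom a F) (S_term s),
      abs_cvg [set: {ffun 'I_w -> nat}] (zetaG_term s x) &
      partial_S s a F = (-1) ^+ A * cpow F%:R (- s) * zetaG w s x].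
Proof.
move=> A x.
have A_gt0 : (0 < A)%N.
  rewrite /A (bigD1 (Ordinal w_gt0)) //= addn_gt0.
  by have /andP[->] := a_bnd (Ordinal w_gt0).
have zetaG_cvg : abs_cvg [set: {ffun 'I_w -> nat}] (zetaG_term s x).
  have -> : x = (A%:R / F%:R : R)%:C by rewrite fmorph_div !rmorph_nat.
  by apply: abs_cvg_zetaG; rewrite ?divr_gt0 ?ltr0n.
have lift_inj : set_inj [set: {ffun 'I_w -> nat}] (lift_residue F a).
  by move=> m n _ _; exact: lift_residue_inj.
have S_termE : S_term s \o lift_residue F a =
    fun n => (-1) ^+ A * cpow F%:R (- s) * zetaG_term s x n.
  by apply/funext => n; exact: S_term_lift_residue.
split => //.
- by rewrite -range_lift_residue // abs_cvg_image // S_termE; exact: abs_cvgZl.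
- rewrite /partial_S -range_lift_residue // csum_image // S_termE csumZ.
  exact: mulrCA.
Qed.
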